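(* Let $(X,\mathcal{T})$ be an anti-topological space with $|X|>3$. Then $(X,\mathcal{T})$ is not a door anti-topological space.
   Context: Let $X$ be a non-empty set. A family $\mathcal{T}\subseteq P(X)$ is an anti-topology on $X$ (and $(X,\mathcal{T})$ is an anti-topological space) if: (i) $\emptyset\notin\mathcal{T}$ and $X\notin\mathcal{T}$; (ii) for every $n\in\mathbb{N}$ and all $A_1,\dots,A_n\in\mathcal{T}$ that are not all equal, $\bigcap_{i=1}^n A_i\notin\mathcal{T}$; (iii) for every non-empty index set $J$ and all sets $A_i\in\mathcal{T}$ ($i\in J$) that are not all equal, $\bigcup_{i\in J}A_i\notin\mathcal{T}$. Elements of $\mathcal{T}$ are called anti-open; a set is anti-closed if its complement is anti-open. $(X,\mathcal{T})$ is a door anti-topological space if every subset $A\subseteq X$ with $A\neq\emptyset$ and $A\neq X$ is anti-open or anti-closed. *)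

(* Defs.v *)
(* Equality of subsets is Leibniz equality
   (which coincides with extensional equality under the whitelisted
   functional/propositional extensionality axioms). *)
From Stdlib Require Import Classical FunctionalExtensionality PropExtensionality.

Definition subset_of (X : Type) := X -> Prop.
Definition emptyset {X : Type} : subset_of X := fun _ => False.
Definition fullset {X : Type} : subset_of X := fun _ => True.
Definition complement {X : Type} (A : subset_of X) : subset_of X := fun x => ~ A x.

Definition fin_inter {X : Type} (n : nat) (A : nat -> subset_of X) : subset_of X :=
  fun x => forall i, i < n -> A i x.

Definition big_union {X : Type} {J : Type} (A : J -> subset_of X) : subset_of X :=
  fun x => exists j, A j x.

Definition anti_topology {X : Type} (T : subset_of X -> Prop) : Prop :=
  (~ T emptyset /\ ~ T fullset) /\
  (forall (n : nat) (A : nat -> subset_of X),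
      (forall i, i < n -> T (A i)) ->
      (exists i j, i < n /\ j < n /\ A i <> A j) ->
      ~ T (fin_inter n A)) /\
  (forall (J : Type) (A : J -> subset_of X),
      inhabited J ->
      (forall j, T (A j)) ->
      (exists i j, A i <> A j) ->
      ~ T (big_union A)).

Definition anti_open {X : Type} (T : subset_of X -> Prop) (A : subset_of X) : Prop := T A.
Definition anti_closed {X : Type} (T : subset_of X -> Prop) (A : subset_of X) : Prop :=
  T (complement A).

Definition door_anti_topology {X : Type} (T : subset_of X -> Prop) : Prop :=
  forall A : subset_of X, A <> emptyset -> A <> fullset ->
    anti_open T A \/ anti_closed T A.

Definition card_gt3 (X : Type) : Prop :=
  exists a b c d : X,
    a <> b /\ a <> c /\ a <> d /\ b <> c /\ b <> d /\ c <> d.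

(* Main.v *)
(* Every proper non-empty set is anti-open or anti-closed, so each singleton is
   one or the other.  If some {x} and some X \ {y} (x <> y) were both anti-open,
   their union would be X \ {y} again, a union of distinct anti-open sets.  So
   among three points a, b, c the singletons are all anti-open or all
   anti-closed; complementation exchanges the two cases.  If {a}, {b}, {c} are
   anti-open, the pairs {a,b} and {a,c} cannot be anti-open (unions), hence are
   anti-closed; then {a,b,c} is neither anti-open (a union of three singletons)
   nor anti-closed (its complement is the intersection of those of {a,b} and
   {a,c}) although, by a fourth point d, it is a proper subset. *)
Require Import Defs.
From Stdlib Require Import Classical FunctionalExtensionality PropExtensionality.

Lemma subset_ext {X : Type} (A B : subset_of X) : (forall x, A x <-> B x) -> A = B.
Proof.
  intro H; apply functional_extensionality; intro x.
  apply propositional_extensionality; auto.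
Qed.

Lemma subset_neq_at {X : Type} (A B : subset_of X) (p : X) : A p -> ~ B p -> A <> B.
Proof. intros HA HB E; subst; contradiction. Qed.

Lemma complementK {X : Type} (A : subset_of X) : complement (complement A) = A.
Proof. apply subset_ext; intro x; unfold complement; tauto. Qed.

Lemma complement_inj {X : Type} (A B : subset_of X) :
  A <> B -> complement A <> complement B.
Proof. intros Hne E; apply Hne; rewrite <- (complementK A), E; apply complementK. Qed.

Definition singleton {X : Type} (a : X) : subset_of X := fun x => x = a.

Section Families.
Variable X : Type.
Implicit Types (S : subset_of X -> Prop) (A B C U : subset_of X).

Definition dual S : subset_of X -> Prop := fun A => S (complement A).

Definition union3_free S : Prop :=
  forall A B C U, S A -> S B -> S C -> A <> B ->
    (forall x, U x <-> A x \/ B x \/ C x) -> ~ S U.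

Definition inter3_free S : Prop :=
  forall A B C U, S A -> S B -> S C -> A <> B ->
    (forall x, U x <-> A x /\ B x /\ C x) -> ~ S U.

Definition splits S : Prop :=
  forall A p q, A p -> ~ A q -> S A \/ S (complement A).

Lemma union2_free S : union3_free S ->
  forall A B U, S A -> S B -> A <> B -> (forall x, U x <-> A x \/ B x) -> ~ S U.
Proof. intros H A B U HA HB Hne HU; apply (H A B B); auto; intro x; rewrite HU; tauto. Qed.

Lemma inter2_free S : inter3_free S ->
  forall A B U, S A -> S B -> A <> B -> (forall x, U x <-> A x /\ B x) -> ~ S U.
Proof. intros H A B U HA HB Hne HU; apply (H A B B); auto; intro x; rewrite HU; tauto. Qed.

Lemma dual_union3_free S : inter3_free S -> union3_free (dual S).
Proof.
  intros H A B C U HA HB HC Hne HU; unfold dual in *.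
  apply (H _ _ _ _ HA HB HC (complement_inj A B Hne)).
  intro x; unfold complement; rewrite HU; tauto.
Qed.

Lemma dual_inter3_free S : union3_free S -> inter3_free (dual S).
Proof.
  intros H A B C U HA HB HC Hne HU; unfold dual in *.
  apply (H _ _ _ _ HA HB HC (complement_inj A B Hne)).
  intro x; unfold complement; rewrite HU; tauto.
Qed.

Lemma dual_splits S : splits S -> splits (dual S).
Proof.
  intros H A p q Hp Hq; unfold dual; rewrite complementK.
  destruct (H A p q Hp Hq); auto.
Qed.

Definition triple A B C (n : nat) : subset_of X :=
  match n with 0 => A | 1 => B | _ => C end.

Lemma anti_topology_union3_free S : anti_topology S -> union3_free S.
Proof.
  intros [_ [_ Hunion]] A B C U HA HB HC Hne HU.
  replace U with (big_union (triple A B C)).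
  - apply Hunion.
    + exact (inhabits 0).
    + intros [|[|j]]; auto.
    + exists 0, 1; auto.
  - apply subset_ext; intro x; rewrite HU; split.
    + intros [[|[|j]] h]; simpl in h; tauto.
    + intros [h|[h|h]]; [exists 0 | exists 1 | exists 2]; exact h.
Qed.

Lemma anti_topology_inter3_free S : anti_topology S -> inter3_free S.
Proof.
  intros [_ [Hinter _]] A B C U HA HB HC Hne HU.
  replace U with (fin_inter 3 (triple A B C)).
  - apply Hinter.
    + intros [|[|j]] _; auto.
    + exists 0, 1; auto.
  - apply subset_ext; intro x; rewrite HU; split.
    + intro h; repeat split; [apply (h 0) | apply (h 1) | apply (h 2)]; auto.
    + intros [h1 [h2 h3]] [|[|j]] _; auto.
Qed.

Lemma door_splits S : door_anti_topology S -> splits S.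
Proof.
  intros H A p q Hp Hq; apply H.
  - intro E; rewrite E in Hp; exact Hp.
  - intro E; rewrite E in Hq; exact (Hq I).
Qed.

Variable S : subset_of X -> Prop.
Hypothesis S_union3_free : union3_free S.

Lemma singleton_cosingleton_exclusive x y z :
  x <> y -> z <> x -> z <> y -> S (singleton x) -> ~ S (complement (singleton y)).
Proof.
  intros nxy nzx nzy Hx Hy.
  apply (union2_free S S_union3_free _ _ (complement (singleton y)) Hx Hy); auto.
  - apply not_eq_sym, (subset_neq_at _ _ z); unfold singleton, complement; auto.
  - intro w; unfold singleton, complement; split; [tauto|].
    intros [h|h]; [subst; auto | auto].
Qed.

Hypothesis S_splits : splits S.

Lemma singleton_or_cosingleton a b :
  a <> b -> S (singleton a) \/ S (complement (singleton a)).
Proof. intro nab; apply (S_splits _ a b); unfold singleton; auto. Qed.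

Lemma singletons_uniform a b c d :
  a <> b -> a <> c -> a <> d -> b <> c -> b <> d -> c <> d ->
  (S (singleton a) /\ S (singleton b) /\ S (singleton c)) \/
  (S (complement (singleton a)) /\ S (complement (singleton b)) /\
   S (complement (singleton c))).
Proof.
  intros ab ac ad bc bd cd.
  destruct (singleton_or_cosingleton a d ad) as [Ha|Ha];
  destruct (singleton_or_cosingleton b d bd) as [Hb|Hb];
  destruct (singleton_or_cosingleton c d cd) as [Hc|Hc];
  auto; exfalso;
  match goal with
  | Hx : S (singleton ?x), Hy : S (complement (singleton ?y)) |- _ =>
      exact (singleton_cosingleton_exclusive x y d
               ltac:(congruence) ltac:(congruence) ltac:(congruence) Hx Hy)
  end.
Qed.

Hypothesis S_inter3_free : inter3_free S.

Lemma pair_anti_closed x y q :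
  x <> y -> q <> x -> q <> y -> S (singleton x) -> S (singleton y) ->
  S (complement (fun z => z = x \/ z = y)).
Proof.
  intros xy qx qy Hx Hy.
  destruct (S_splits (fun z => z = x \/ z = y) x q) as [h|h]; auto.
  - intros [e|e]; auto.
  - exfalso; apply (union2_free S S_union3_free _ _ _ Hx Hy) in h; auto.
    + apply (subset_neq_at _ _ x); unfold singleton; auto.
    + unfold singleton; tauto.
Qed.

Lemma not_three_anti_open_singletons a b c d :
  a <> b -> a <> c -> a <> d -> b <> c -> b <> d -> c <> d ->
  S (singleton a) -> S (singleton b) -> ~ S (singleton c).
Proof.
  intros ab ac ad bc bd cd Ha Hb Hc.
  pose proof (pair_anti_closed a b c ab (not_eq_sym ac) (not_eq_sym bc) Ha Hb) as Sab.
  pose proof (pair_anti_closed a c b ac (not_eq_sym ab) bc Ha Hc) as Sac.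
  destruct (S_splits (fun z => z = a \/ z = b \/ z = c) a d) as [h|h]; auto.
  - intros [e|[e|e]]; auto.
  - apply (S_union3_free _ _ _ _ Ha Hb Hc) in h; auto.
    + apply (subset_neq_at _ _ a); unfold singleton; auto.
    + unfold singleton; tauto.
  - apply (inter2_free S S_inter3_free _ _ _ Sab Sac) in h; auto.
    + apply (subset_neq_at _ _ c); unfold complement; intuition.
    + unfold complement; tauto.
Qed.

End Families.

Theorem mainTheorem15 (X : Type) (T : subset_of X -> Prop) :
  anti_topology T -> card_gt3 X -> ~ door_anti_topology T.
Proof.
  intros HT [a [b [c [d [ab [ac [ad [bc [bd cd]]]]]]]]] HD.
  pose proof (anti_topology_union3_free X T HT) as Hunion.
  pose proof (anti_topology_inter3_free X T HT) as Hinter.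
  pose proof (door_splits X T HD) as Hsplit.
  destruct (singletons_uniform X T Hunion Hsplit a b c d ab ac ad bc bd cd)
    as [[Ha [Hb Hc]] | [Ha [Hb Hc]]].
  - exact (not_three_anti_open_singletons X T Hunion Hsplit Hinter
             a b c d ab ac ad bc bd cd Ha Hb Hc).
  - exact (not_three_anti_open_singletons X (dual X T)
             (dual_union3_free X T Hinter) (dual_splits X T Hsplit)
             (dual_inter3_free X T Hunion) a b c d ab ac ad bc bd cd Ha Hb Hc).
Qed.
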